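(* Let $\Theta\subseteq\mathbb{R}^s$ and let $\{f(\cdot,\theta):\theta\in\Theta\}$ be a family of probability distributions of the form $$f(x,\theta)=K(x)\exp\Big\{\sum_{k=1}^{s}\theta_kT_k(x)+A(\theta)\Big\},\qquad x\in\mathcal{X},\ \theta=(\theta_1,\dots,\theta_s)^t\in\Theta,$$ where $\mathcal{X}\subseteq\mathbb{R}$ is a Borel set, not depending on $\theta$, with $\mathcal{X}=\{x: f(x,\theta)>0\}$ for all $\theta\in\Theta$. Let $y_1,\dots,y_k\in\mathcal{X}$ be a basis of observations which characterizes this family. Let $X_1,\dots,X_n$ be a sample from $f(\cdot,\theta)$, where $\theta\in\Theta$ is the true parameter, let $\widehat f_n$ be the empirical distribution with support $\{y_1,\dots,y_k\}$ obtained from this sample, and let $$\widetilde\theta_n=\arg\min_{\theta'\in\Theta} d_v\big(f(\cdot,\theta'),\widehat f_n\big)$$ be the estimator by the minimum of the distance in variations $d_v$. If the set of natural parameters $\Theta$ is convex and the true parameter $\theta$ is an interior point of $\Theta$, then $\widetilde\theta_n$ converges in probability to $\theta$ as $n\to\infty$, i.e. $\widetilde\theta_n\overset{P}{\longrightarrow}\theta$.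
   Context: Distributions $f(\cdot,\theta)$ are either probability mass functions (discrete case) or probability densities with respect to Lebesgue measure on $\mathbb{R}$ (continuous case); the $X_i$ are independent with distribution $f(\cdot,\theta)$. Basis of observations: for distinct points $y_1,\dots,y_k$ (with $k\ge 2$) in the support and a distribution $f$ of the family, the auxiliary distribution $\bar f$ of $f$ based on $y_1,\dots,y_k$ is the discrete distribution on $\{y_1,\dots,y_k\}$ with $\bar f(y_i)=f(y_i)/\sum_{j=1}^k f(y_j)$. The points $y_1,\dots,y_k$ form a basis of observations which characterizes the family if the correspondence $f\mapsto\bar f$ is a bijection from the family onto the set of auxiliary distributions; here, the family being indexed by $\theta$, this means that $\theta\mapsto\bar f(\cdot,\theta)$ is injective on $\Theta$. The points $y_1,\dots,y_k$ are fixed (they do not depend on $n$). Empirical distribution: $\widehat f_n$ is given by a table of empirical frequencies $(y_1,\widehat f_n(y_1)),\dots,(y_k,\widehat f_n(y_k))$ with $\sum_i\widehat f_n(y_i)=1$. In the discrete case $\widehat f_n(y_i)=n_i/\sum_j n_j$, where $n_i$ is the number of observations equal to $y_i$. In the continuous case it is obtained by grouping the observations into classes represented by $y_1,\dots,y_k$, and the following convention is in force: for all $i,j$, $\widehat f_n(y_i)/\widehat f_n(y_j)$ converges in probability to $f(y_i,\theta)/f(y_j,\theta)$, where $\theta$ is the true parameter (in the discrete case this holds by the law of large numbers). Distance in variations between $f(\cdot,\theta')$ and $\widehat f_n$ on $\{y_1,\dots,y_k\}$: $$d_v\big(f(\cdot,\theta'),\widehat f_n\big)=\sum_{i,j\in\{1,\dots,k\}}\left|\frac{\widehat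 f_n(y_i)}{\widehat f_n(y_j)}-\frac{f(y_i,\theta')}{f(y_j,\theta')}\right|,$$ defined when all $\widehat f_n(y_i)>0$. The estimator $\widetilde\theta_n$ is understood as a $\Theta$-valued random vector which is a minimizer of $\theta'\mapsto d_v(f(\cdot,\theta'),\widehat f_n)$ over $\Theta$ whenever all $\widehat f_n(y_i)$ are positive (such a minimizer being assumed to exist); it may be chosen arbitrarily otherwise. *)

(* Defs.v *)
From HB Require Import structures.
From mathcomp Require Import all_boot all_order all_algebra finmap.
From mathcomp Require Import all_classical all_reals all_analysis.
Set Implicit Arguments.
Unset Strict Implicit.
Unset Printing Implicit Defensive.
Import Order.TTheory GRing.Theory Num.Theory.
Import numFieldNormedType.Exports.
Local Open Scope classical_set_scope.
Local Open Scope ring_scope.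

Variant setting := DiscreteCase | ContinuousCase.

Definition is_probability_law (R : realType) (c : setting) (f : R -> R) : Prop :=
  match c with
  | DiscreteCase =>
      (forall x, 0 <= f x) /\ (\esum_(x in [set: R]) (f x)%:E = 1)%E
  | ContinuousCase =>
      [/\ measurable_fun setT f, (forall x, 0 <= f x) &
          (\int[lebesgue_measure]_x (f x)%:E = 1)%E]
  end.

Definition has_law d (Omega : measurableType d) (R : realType)
    (P : probability Omega R) (c : setting) (X : {RV P >-> R}) (f : R -> R)
    : Prop :=
  match c with
  | DiscreteCase => forall x, pmf X x = f x
  | ContinuousCase => forall B, measurable B ->
      (distribution P X B = \int[lebesgue_measure]_(x in B) (f x)%:E)%E
  end.

Definition mutually_independent d (Omega : measurableType d) (R : realType)
    (P : probability Omega R) (X : nat -> {RV P >-> R}) : Prop :=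
  forall (J : {fset nat}) (B : nat -> set R),
    (forall m, measurable (B m)) ->
    (P (\bigcap_(m in [set` J]) (X m @^-1` B m)) =
     \prod_(m <- J) P (X m @^-1` B m))%E.

Definition cvg_in_probability d (Omega : measurableType d) (R : realType)
    (P : probability Omega R) (V : normedModType R)
    (Y : nat -> Omega -> V) (l : V) : Prop :=
  forall e : R, 0 < e ->
    P [set w | e <= `|Y n w - l|] @[n --> \oo] --> 0%E.

Definition exponential_form (R : realType) (s : nat) (Theta : set 'rV[R]_s)
    (XX : set R) (f : R -> 'rV[R]_s -> R)
    (K : R -> R) (T : 'I_s -> R -> R) (A : 'rV[R]_s -> R) : Prop :=
  forall x theta, XX x -> Theta theta ->
    f x theta = K x * expR ((\sum_(j < s) theta ord0 j * T j x) + A theta).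

(* A distribution on {y_0, ..., y_(k-1)} is encoded by the function sending the
   index i to the mass of y_i. *)
Definition auxiliary (R : realType) (k : nat) (y : 'I_k -> R) (f : R -> R)
    : 'I_k -> R :=
  fun i => f (y i) / \sum_(j < k) f (y j).

Definition basis_of_observations (R : realType) (s k : nat)
    (Theta : set 'rV[R]_s) (XX : set R) (f : R -> 'rV[R]_s -> R)
    (y : 'I_k -> R) : Prop :=
  [/\ (2 <= k)%N, injective y, (forall i, XX (y i)) &
      set_inj Theta (fun theta => auxiliary y (f ^~ theta))].

(* Since x / 0 = 0, all frequencies are 0 when no observation falls in any
   class. *)
Definition frequency (R : realType) (k n : nat) (C : 'I_k -> set R)
    (x : 'I_n -> R) (i : 'I_k) : R :=
  (\sum_(m < n) \1_(C i) (x m)) / \sum_(j < k) \sum_(m < n) \1_(C j) (x m).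

(* In the continuous case the classes may depend on the sample and need not
   cover the line. *)
Definition empirical_distribution d (Omega : measurableType d) (R : realType)
    (P : probability Omega R) (c : setting) (k : nat) (y : 'I_k -> R)
    (X : nat -> {RV P >-> R}) (fhat : nat -> Omega -> 'I_k -> R) : Prop :=
  match c with
  | DiscreteCase => forall n w i,
      fhat n w i = frequency (fun j => [set y j]) (fun m : 'I_n => X m w) i
  | ContinuousCase =>
      (forall n i, measurable_fun setT (fun w => fhat n w i)) /\
      exists C : forall n, ('I_n -> R) -> 'I_k -> set R,
        (forall n x, trivIset setT (C n x)) /\
        (forall n w i,
           fhat n w i = frequency (C n (fun m => X m w)) (fun m : 'I_n => X m w) i)
  end.

Definition dist_variations (R : realType) (k : nat) (y : 'I_k -> R)
    (f : R -> R) (g : 'I_k -> R) : R :=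
  \sum_(i < k) \sum_(j < k) `| g i / g j - f (y i) / f (y j) |.

Definition is_argmin (R : realType) (V : Type) (D : set V) (F : V -> R) (v : V)
    : Prop :=
  D v /\ forall v', D v' -> F v <= F v'.

(* Main.v *)
Require Import Defs.
From HB Require Import structures.
From mathcomp Require Import all_boot all_order all_algebra finmap.
From mathcomp Require Import all_classical all_reals all_analysis.
From mathcomp Require Import measurable_realfun.
From mathcomp Require Import ring lra.
Set Implicit Arguments.
Unset Strict Implicit.
Unset Printing Implicit Defensive.
Import Order.TTheory GRing.Theory Num.Theory.
Import numFieldNormedType.Exports.
Local Open Scope classical_set_scope.
Local Open Scope ring_scope.

(** The distance in variations only sees the ratios f(y_i, t) / f(y_j, t), and
    in an exponential family the logarithm of such a ratio is, up to a constant
    independent of t, the linear form sum_l t_l (T_l(y_i) - T_l(y_j)).  Fix a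
    point y_(i0).  The log-ratios against y_(i0) thus move with t through one
    matrix M of differences of the statistics ([ln_ratio_linear]).  If v M = 0,
    then t and t + a v have the same auxiliary distribution whenever both lie in
    Theta; as theta is interior, some a > 0 is allowed, and the
    characterization by the basis of observations gives v = 0.  Hence M is row
    free ([statistic_differences_free]), so it has a right inverse and
    |v| is controlled by the entries of v M; with the continuity of ln this
    yields stability: a parameter whose ratios are close to those of theta is
    close to theta ([ratios_stable]).

    The rest is a comparison.  If the empirical ratios are within eta of those
    of theta, then d_v at theta is at most k^2 eta, so d_v at the minimizer is
    too, and the triangle inequality puts the ratios of the minimizer within
    (k^2 + 1) eta of those of theta ([argmin_ratios_close]).  Therefore
    convergence in probability of the empirical ratios carries over to the
    estimator ([cvg_in_probability_controlled]).  For a continuous law this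
    convergence of the ratios is a hypothesis; for a discrete law it is the weak
    law of large numbers applied to the events X_m = y_i
    ([weak_law_of_events], [cvg_frequency_ratio]). *)

(** * Convergence in probability *)

(** Inversion is continuous only away from 0, so the point 0 is treated apart as
    a measurable singleton. *)
Lemma measurable_fun_inv d (U : measurableType d) (R : realType) (D : set U)
    (g : U -> R) :
  measurable_fun D g -> measurable_fun D (fun x => (g x)^-1).
Proof.
move=> mg; apply: measurableT_comp mg => //.
rewrite -(setUv [set 0 : R]).
apply/measurable_funU => //; first exact: measurableC.
split.
  exact: measurable_fun_set1.
apply: open_continuous_measurable_fun.
  rewrite openC; exact: closed_eq.
move=> x; rewrite inE /= => /eqP x0; exact: inv_continuous.
Qed.

Lemma measurable_dist_ge d (U : measurableType d) (R : realType)
    (g : U -> R) (l e : R) :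
  measurable_fun setT g -> measurable [set w | e <= `|g w - l|].
Proof.
move=> mg; have : measurable_fun setT (fun w => e <= `|g w - l|).
  apply: measurable_fun_ler => //; apply: measurableT_comp => //.
  exact: measurable_funB.
by move=> /(_ measurableT [set true]); rewrite setTI; exact.
Qed.

(** The norm is the largest modulus of an entry; positivity of [e] excludes the
    default value 0 of that maximum, which is what remains when [s] is 0. *)
Lemma measurable_rV_dist_ge d (U : measurableType d) (R : realType) (s : nat)
    (g : U -> 'rV[R]_s) (l : 'rV[R]_s) (e : R) : 0 < e ->
  (forall j, measurable_fun setT (fun w => g w ord0 j)) ->
  measurable [set w | e <= `|g w - l|].
Proof.
move=> e0 mg.
rewrite [X in measurable X](_ : _ = \bigcup_(j in [set: 'I_s])
    [set w | e <= `|g w ord0 j - l ord0 j|]).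
  apply: fin_bigcup_measurable => // j _; exact: measurable_dist_ge.
apply/seteqP; split => [w|w [j _] h] /=;
    rewrite [leRHS]/Num.Def.normr /= mx_normrE.
  move=> /bigmax_geP [|[[i j] _]] /=; first by rewrite leNgt e0.
  by rewrite !mxE (ord1 i) => ?; exists j.
by apply/bigmax_geP; right; exists (ord0, j) => //=; rewrite !mxE.
Qed.

(** The event that [Z] is far from [z] is covered by the finitely many events that
    some [Y i] is far from [l i], so a union bound suffices.  Unlike in a
    continuous mapping theorem, [Z] need not be a function of the [Y i], which is
    what an arbitrarily chosen minimizer requires. *)
Lemma cvg_in_probability_controlled d (Omega : measurableType d) (R : realType)
    (P : probability Omega R) (V : normedModType R) (I : finType)
    (Y : I -> nat -> Omega -> R) (l : I -> R) (Z : nat -> Omega -> V) (z : V) :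
  (forall i n, measurable_fun setT (Y i n)) ->
  (forall (e : R) n, 0 < e -> measurable [set w | e <= `|Z n w - z|]) ->
  (forall i, cvg_in_probability P (Y i) (l i)) ->
  (forall e : R, 0 < e -> exists2 delta : R, 0 < delta &
     forall n w, (forall i, `|Y i n w - l i| < delta) -> `|Z n w - z| < e) ->
  cvg_in_probability P Z z.
Proof.
move=> mY mZ cY YZ e e0; have [delta delta0 YZe] := YZ e e0.
pose B i n : set Omega := [set w | delta <= `|Y i n w - l i|].
have mB i n : measurable (B i n) by exact: measurable_dist_ge.
have cS : (\sum_(i : I) P (B i n))%E @[n --> \oo] --> 0%E.
  have := @cvg_nnesum nat \oo _ R I (index_enum I) (fun i n => P (B i n))
    (fun=> 0%E) xpredT.
  rewrite big1//; apply=> i _; [exact: nearW | exact: cY].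
apply: squeeze_cvge (cvg_cst 0%E) cS.
apply: nearW => n; apply/andP; split => //.
apply: (@le_trans _ _ (P (\big[setU/set0]_(i : I) B i n))).
  apply: le_measure; rewrite ?inE; first exact: mZ.
    apply: bigsetU_measurable => i _; exact: mB.
  move=> w /= eZ; rewrite -bigcup_seq; apply: contrapT => nY.
  move: eZ; rewrite leNgt YZe// => i; rewrite ltNge; apply/negP => h.
  by apply: nY; exists i => //=; rewrite mem_index_enum.
elim: (index_enum I) => [|i r IH]; first by rewrite !big_nil measure0.
rewrite !big_cons; apply: le_trans (leeD (lexx _) IH).
apply: measureU2; first exact: mB.
by apply: bigsetU_measurable => j _; exact: mB.
Qed.

(** * The weak law of large numbers for events *)

Lemma indic_Lfun2 d (Omega : measurableType d) (R : realType)
    (P : probability Omega R) (A : set Omega) :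
  measurable A -> (\1_A : Omega -> R) \in Lfun P 2%:E.
Proof.
move=> mA; rewrite inE; apply/andP; split; rewrite inE//=.
rewrite /finite_norm unlock /Lnorm poweR_lty//.
rewrite (eq_integral (EFin \o \1_A)); last first.
  move=> x _ /=; rewrite ger0_norm// powR_mulrn// indicE.
  by case: (_ \in _); rewrite /= ?expr1n ?expr0n.
by rewrite integral_indic// setIT ltey_eq fin_num_measure.
Qed.

Section weak_law_of_large_numbers.
Context d (Omega : measurableType d) (R : realType) (P : probability Omega R).
Context (A : nat -> set Omega) (p : R).
Context (mA : forall m, measurable (A m))
  (PA : forall m, P (A m) = p%:E)
  (PAA : forall m n : nat, m != n -> P (A m `&` A n) = (p * p)%:E).

Let S n : Omega -> R := fun w => \sum_(m < n) \1_(A m) w.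

Let SS n : S n.+1 = S n \+ \1_(A n).
Proof. by apply/funext => w; rewrite /S big_ord_recr. Qed.

Let S0 : S 0 = cst 0.
Proof. by apply/funext => w; rewrite /S big_ord0. Qed.

Let S_Lfun2 n : S n \in Lfun P 2%:E.
Proof.
elim: n => [|n IH]; first by rewrite S0 Lfun_cst.
by rewrite SS rpredD ?lee1n//= => ?; exact: indic_Lfun2.
Qed.

Let Lfun21 (g : Omega -> R) : g \in Lfun P 2%:E -> g \in Lfun P 1.
Proof. by apply: Lfun_subset12; exact: fin_num_measure. Qed.

Let expectation_count n : ('E_P[S n] = (n%:R * p)%:E)%E.
Proof.
elim: n => [|n IH]; first by rewrite S0 expectation_cst mul0r.
rewrite SS expectationD ?Lfun21 ?indic_Lfun2// IH expectation_indic// PA.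
by rewrite -EFinD mulrSr mulrDl mul1r.
Qed.

(* Pairwise independence enters here only: the cross terms of the variance of
   the count vanish, so that this variance grows linearly. *)
Let covariance_count n m : (n <= m)%N -> covariance P (S n) (\1_(A m)) = 0%E.
Proof.
elim: n => [|n IH] nm; first by rewrite S0 covariance_cst_l.
rewrite SS covarianceDl ?indic_Lfun2// IH ?(ltnW nm)// add0e.
rewrite covarianceE ?Lfun2_mul_Lfun1 ?Lfun21 ?indic_Lfun2//.
rewrite (_ : \1_(A n) * \1_(A m) = \1_(A n `&` A m)); last by rewrite indicI.
rewrite !expectation_indic ?PAA ?PA ?ltn_eqF//; last exact: measurableI.
by rewrite -EFinM subee.
Qed.

Let variance_count n : ('V_P[S n] = (n%:R * (p - p * p))%:E)%E.
Proof.
elim: n => [|n IH]; first by rewrite S0 variance_cst mul0r.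
rewrite SS varianceD ?indic_Lfun2// IH covariance_count// mule0 adde0.
rewrite varianceE ?indic_Lfun2//.
rewrite [X in 'E_P[X]%E](_ : _ = \1_(A n)); last first.
  by rewrite expr2 -[in RHS](setIid (A n)) indicI.
rewrite expectation_indic// PA -[(p%:E ^+ 2)%E]EFinM.
by rewrite -EFinB -EFinD mulrSr mulrDl mul1r.
Qed.

(** Chebyshev's inequality for the count at the threshold [e * n], where the
    variance is [n * (p - p * p)], leaves a bound of order 1 / n. *)
Lemma weak_law_of_events :
  cvg_in_probability P (fun n w => (\sum_(m < n) \1_(A m) w) / n%:R : R) p.
Proof.
move=> e e0.
have mS n : measurable_fun setT (S n)
  by apply: measurable_sum => m; exact: measurable_indic.
pose B n : set Omega := [set w | e <= `|S n w / n%:R - p|].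
have BE n : (0 < n)%N ->
    (P (B n) <= ((e ^- 2 * (p - p * p)) / n%:R)%:E)%E.
  move=> n0; have n0R : 0 < n%:R :> R by rewrite ltr0n.
  pose Sn := mfun_Sub (mem_set (mS n)).
  have := @chebyshev _ _ R P Sn (e * n%:R) (mulr_gt0 e0 n0R).
  rewrite /Sn /= expectation_count variance_count /=.
  rewrite -EFinM => cheb; apply: le_trans (le_trans _ cheb) _; last first.
    rewrite lee_fin exprMn invfM -!mulrA ler_wpM2l ?invr_ge0 ?sqr_ge0//.
    by rewrite (mulrC (p - _)) expr2 invfM -mulrA mulKf ?gt_eqF.
  rewrite le_eqVlt; apply/orP; left; apply/eqP; congr (P _).
  apply/seteqP; split=> w; rewrite /B /= => ew.
    rewrite -ler_pdivlMr// -[X in _ / X]gtr0_norm// -normrV ?unitfE ?gt_eqF//.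
    by rewrite -normrM mulrBl [n%:R * p]mulrC mulfK ?gt_eqF.
  move: ew; rewrite -ler_pdivlMr// -[X in _ / X]gtr0_norm//.
  rewrite -normrV ?unitfE ?gt_eqF//.
  by rewrite -normrM mulrBl [n%:R * p]mulrC mulfK ?gt_eqF.
have cB : ((e ^- 2 * (p - p * p)) / n%:R)%:E @[n --> \oo] --> (0 : R)%:E.
  apply: cvg_EFin => /=; first exact: nearW.
  rewrite -[X in _ --> X](mulr0 (e ^- 2 * (p - p * p))).
  apply: cvgM; first exact: cvg_cst.
  by rewrite -(cvg_shiftS (fun n => n%:R^-1 : R)); exact: cvg_harmonic.
apply: squeeze_cvge (cvg_cst 0%E) cB.
near=> n; rewrite measure_ge0 /= BE//; near: n; exact: nbhs_infty_gt.
Unshelve. all: by end_near. Qed.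

End weak_law_of_large_numbers.

(** * Empirical ratios in the discrete case *)

Lemma divf_common (F : fieldType) (a b c : F) :
  c != 0 -> (a / c) / (b / c) = a / b.
Proof. by move=> c0; rewrite invfM invrK mulrACA mulVf// mulr1. Qed.

Lemma div_continuous_at (R : realType) (p q e : R) : 0 < q -> 0 < e ->
  exists2 delta : R, 0 < delta & forall a b,
    `|a - p| < delta -> `|b - q| < delta -> `|a / b - p / q| < e.
Proof.
move=> q0 e0.
have : (z.1 / z.2) @[z --> (p, q)] --> p / q.
  apply: cvgM; first exact: cvg_fst.
  by apply: cvgV; [rewrite gt_eqF | exact: cvg_snd].
move=> /cvgrPdist_lt/(_ e e0)/nbhs_ballP[delta /= delta0 h].
exists delta => // a b ap bq; rewrite distrC; apply: (h (a, b)).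
by split; rewrite /ball /= distrC.
Qed.

Section discrete_frequencies.
Context d (Omega : measurableType d) (R : realType) (P : probability Omega R).
Context (X : nat -> {RV P >-> R}) (f : R -> R).
Context (X_indep : mutually_independent X)
  (X_law : forall m x, pmf (X m) x = f x).

Lemma cvg_point_frequency (x : R) :
  cvg_in_probability P
    (fun n w => (\sum_(m < n) \1_[set x] (X m w)) / n%:R : R) (f x).
Proof.
have mX m : measurable (X m @^-1` [set x]).
  by rewrite -[X in measurable X]setTI; exact: measurable_funP.
have PX m : P (X m @^-1` [set x]) = (f x)%:E.
  by rewrite -(X_law m) fineK// fin_num_measure.
apply: (weak_law_of_events (A := fun m => X m @^-1` [set x])) => // m n mn.
have := X_indep [fset m; n]%fset (fun=> measurable_set1 x).
rewrite (big_fsetD1 m) ?fset21//=.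
have -> : ([fset m; n] `\ m = [fset n])%fset.
  apply/fsetP => i; rewrite !inE; case: eqP => [->|//] /=.
  by rewrite (negbTE mn).
rewrite big_seq_fset1 !PX EFinM => <-; congr (P _).
apply/seteqP; split => [w [wm wn] i /=|w h].
  by rewrite !inE => /orP[] /eqP ->.
by split; apply: h => /=; rewrite !inE eqxx ?orbT.
Qed.

(** The total count of the frequencies is random, but it cancels in a ratio, which
    is thus a ratio of two means covered by the weak law.  Samples that meet none
    of the points cause no trouble: both sides are then 0. *)
Lemma cvg_frequency_ratio (k : nat) (y : 'I_k -> R) (i j : 'I_k) :
  0 < f (y j) ->
  let fhat n w := frequency (fun j => [set y j]) (fun m : 'I_n => X m w) in
  cvg_in_probability P (fun n w => fhat n w i / fhat n w j : R)
    (f (y i) / f (y j)).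
Proof.
move=> fj fhat.
pose N i n w : R := \sum_(m < n) \1_[set y i] (X m w).
have N_ge0 l n w : 0 <= N l n w by apply: sumr_ge0.
have ratioE n w : fhat n w i / fhat n w j = (N i n w / n%:R) / (N j n w / n%:R).
  rewrite /fhat /frequency.
  have [->|n0] := eqVneq n 0%N; first by rewrite /N !big_ord0 !mul0r.
  rewrite [RHS]divf_common ?pnatr_eq0//.
  have [D0|/divf_common//] := eqVneq (\sum_l N l n w) 0.
  have N0 l : N l n w = 0.
    by apply: (psumr_eq0P _ D0).
  by rewrite -/(N i n w) -/(N j n w) !N0 !mul0r.
have mN l n : measurable_fun setT (fun w => N l n w / n%:R).
  apply: measurable_funM => //; apply: measurable_sum => m.
  by apply: measurableT_comp => //; exact: measurable_indic.
(* The two means are indexed by a boolean: numerator or denominator. *)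
pose Y (b : bool) n w := N (if b then i else j) n w / n%:R.
apply: (@cvg_in_probability_controlled _ _ _ _ _ bool Y
  (fun b => f (y (if b then i else j)))).
- by move=> b n; exact: mN.
- move=> e n e0; apply: measurable_dist_ge.
  under eq_fun do rewrite ratioE.
  by apply: measurable_funM => //; exact: measurable_fun_inv.
- by move=> b; exact: cvg_point_frequency.
- move=> e e0; have [delta delta0 h] := div_continuous_at (f (y i)) fj e0.
  exists delta => // n w hY; rewrite ratioE.
  exact: h (hY true) (hY false).
Qed.

End discrete_frequencies.

(** * Ratios in an exponential family determine the parameter *)

(** An auxiliary distribution is unchanged when [f] is rescaled, hence it depends
    only on the ratios to one reference point. *)
Lemma auxiliary_ratios (R : realType) (k : nat) (y : 'I_k -> R) (f : R -> R)
    (i0 : 'I_k) :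
  f (y i0) != 0 ->
  auxiliary y f =
    fun i => f (y i) / f (y i0) / \sum_(j < k) f (y j) / f (y i0).
Proof.
by move=> f0; apply/funext => i; rewrite -mulr_suml divf_common.
Qed.

(** A right inverse [C] of [M] recovers [v] as [v *m M *m C], and multiplication
    by [C] increases the largest modulus of an entry at most by the sum of the
    moduli of the entries of [C]. *)
Lemma row_free_lower_bound (R : realType) (s k : nat) (M : 'M[R]_(s, k))
    (e : R) : row_free M -> 0 < e ->
  exists2 eta : R, 0 < eta & forall v : 'rV[R]_s,
    (forall i, `|(v *m M) ord0 i| < eta) -> `|v| < e.
Proof.
move=> /row_freeP[C MC] e0.
pose B := \sum_(j < s) \sum_(i < k) `|C i j|.
have B0 : 0 <= B by apply: sumr_ge0 => j _; apply: sumr_ge0.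
(* Adding 1 keeps the denominator positive when C vanishes. *)
exists (e / (1 + B)); first by rewrite divr_gt0// ltr_pwDl.
move=> v hv; rewrite [ltLHS]/Num.Def.normr /= mx_normrE.
apply/bigmax_ltP; split => // -[a j] _ /=; rewrite (ord1 a) {a}.
rewrite -(mulmx1 v) -MC mulmxA mxE.
apply: le_lt_trans (ler_norm_sum _ _ _) _.
apply: (@le_lt_trans _ _ (e / (1 + B) * B)); last first.
  by rewrite -mulrA gtr_pMr// mulrC ltr_pdivrMr ?ltr_pwDl// mul1r ltrDr.
apply: (@le_trans _ _ (e / (1 + B) * \sum_(i < k) `|C i j|)).
  rewrite mulr_sumr; apply: ler_sum => i _.
  by rewrite normrM ler_wpM2r// ltW.
rewrite ler_pM2l ?divr_gt0 ?ltr_pwDl// /B (bigD1 j)//= lerDl.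
by apply: sumr_ge0 => l _; apply: sumr_ge0.
Qed.

Lemma interior_segment (R : realType) (V : normedModType R) (D : set V)
    (x v : V) : D° x -> exists2 t : R, 0 < t & D (x + t *: v).
Proof.
move=> /nbhs_ballP[r /= r0 rD].
exists (r / (1 + `|v|)); first by rewrite divr_gt0// ltr_pwDl.
apply: rD; rewrite -ball_normE /ball_ /= opprD addrA subrr add0r normrN.
rewrite normrZ gtr0_norm ?divr_gt0 ?ltr_pwDl//.
by rewrite -mulrA gtr_pMr// mulrC ltr_pdivrMr ?ltr_pwDl// mul1r ltrDr.
Qed.

Section exponential_family_ratios.
Context (R : realType) (s k : nat) (Theta : set 'rV[R]_s) (XX : set R)
  (f : R -> 'rV[R]_s -> R) (K : R -> R) (T : 'I_s -> R -> R)
  (A : 'rV[R]_s -> R) (y : 'I_k -> R).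
Context
  (f_supp : forall theta, Theta theta -> XX = [set x | 0 < f x theta])
  (f_exp : exponential_form Theta XX f K T A)
  (y_basis : basis_of_observations Theta XX f y).

Lemma basis_gt0 theta i : Theta theta -> 0 < f (y i) theta.
Proof.
have [_ _ yX _] := y_basis.
by move=> /f_supp XE; move: (yX i); rewrite XE.
Qed.

(** The matrix of the linear part of the log-ratios of the family against the
    reference point of index [i0]. *)
Definition statistic_differences (i0 : 'I_k) : 'M[R]_(s, k) :=
  \matrix_(l, i) (T l (y i) - T l (y i0)).

(** The normalization [A] cancels between the two points of a ratio and the
    carrier [K] cancels between the two parameters. *)
Lemma ln_ratio_linear (i0 i : 'I_k) theta theta' :
  Theta theta -> Theta theta' ->
  ln (f (y i) theta' / f (y i0) theta') - ln (f (y i) theta / f (y i0) theta)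
  = ((theta' - theta) *m statistic_differences i0) ord0 i.
Proof.
have [_ _ yX _] := y_basis.
move=> th th'.
have lnf j t : Theta t ->
    ln (f (y j) t) = ln (K (y j)) + (\sum_(l < s) t ord0 l * T l (y j) + A t).
  move=> tT; have := basis_gt0 j tT.
  rewrite f_exp// pmulr_lgt0 ?expR_gt0// => K0.
  by rewrite lnM ?posrE ?expR_gt0// expRK.
rewrite !ln_div ?posrE ?basis_gt0// !lnf// mxE.
transitivity (\sum_(l < s)
  (theta' ord0 l * T l (y i) - theta' ord0 l * T l (y i0)
   - (theta ord0 l * T l (y i) - theta ord0 l * T l (y i0)))).
  rewrite !sumrB; lra.
by apply: eq_bigr => l _; rewrite !mxE; ring.
Qed.

(** A vector in the left kernel is a direction along which no ratio changes.
    Inside [Theta] there is room to move along it, so injectivity of the auxiliary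
    distributions forces it to vanish. *)
Lemma statistic_differences_free (i0 : 'I_k) theta :
  Theta° theta -> row_free (statistic_differences i0).
Proof.
have [_ _ _ inj] := y_basis.
move=> th; have thT := interior_subset th.
apply: inj_row_free => v vM.
have [t t0 tT] := interior_segment v th.
suff /esym/eqP : theta = theta + t *: v.
  by rewrite -subr_eq0 addrAC subrr add0r scaler_eq0 gt_eqF//= => /eqP.
apply: inj; rewrite ?inE// (auxiliary_ratios (i0 := i0)) ?gt_eqF ?basis_gt0//.
rewrite (auxiliary_ratios (i0 := i0)) ?gt_eqF ?basis_gt0//.
have rE i : f (y i) theta / f (y i0) theta =
    f (y i) (theta + t *: v) / f (y i0) (theta + t *: v).
  apply: ln_inj; rewrite ?posrE ?divr_gt0 ?basis_gt0//.
  apply/esym/eqP; rewrite -subr_eq0 ln_ratio_linear//.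
  by rewrite addrAC subrr add0r -scalemxAl vM scaler0 mxE.
apply/funext => i; rewrite rE; congr (_ / _).
exact: eq_bigr.
Qed.

(** This quantifies the injectivity of the auxiliary distributions at an interior
    point, over the whole of [Theta] and not only near [theta]: the log-ratios are
    affine in the parameter, so a lower bound on their variation is global. *)
Lemma ratios_stable (i0 : 'I_k) theta (e : R) : Theta° theta -> 0 < e ->
  exists2 delta : R, 0 < delta & forall theta', Theta theta' ->
    (forall i, `|f (y i) theta' / f (y i0) theta' -
                 f (y i) theta / f (y i0) theta| < delta) ->
    `|theta' - theta| < e.
Proof.
move=> th e0; have thT := interior_subset th.
have [eta eta0 he] :=
  row_free_lower_bound (statistic_differences_free i0 th) e0.
pose r i := f (y i) theta / f (y i0) theta.
have /choice[delta hdelta] i : exists delta : R, 0 < delta /\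
    forall x, `|x - r i| < delta -> `|ln x - ln (r i)| < eta.
  have r0 : 0 < r i by rewrite divr_gt0// basis_gt0.
  have /cvgrPdist_lt/(_ eta eta0)/nbhs_ballP[delta /= d0 h] := continuous_ln r0.
  exists delta; split => // x; rewrite distrC => xr; rewrite distrC; exact: h.
exists (\big[Order.min/1]_i delta i).
  by apply/bigmin_gtP; split => // i _; have [] := hdelta i.
move=> theta' th' hr; apply: he => i; rewrite -ln_ratio_linear//.
have [_] := hdelta i; apply; apply: lt_le_trans (hr i) _.
exact: bigmin_le_cond.
Qed.

End exponential_family_ratios.

(** * Consistency of the minimum distance estimator *)

Lemma dist_variations_term_le (R : realType) (k : nat) (y : 'I_k -> R)
    (f : R -> R) (g : 'I_k -> R) (i j : 'I_k) :
  `|g i / g j - f (y i) / f (y j)| <= dist_variations y f g.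
Proof.
rewrite /dist_variations (bigD1 i)//= (bigD1 j)//= -addrA lerDl addr_ge0//.
  exact: sumr_ge0.
by apply: sumr_ge0 => l _; apply: sumr_ge0.
Qed.

(** The factor is [k * k] for the terms of the distance at [theta], which bounds
    the distance at the minimizer, plus 1 for the passage from [g] back to
    [theta]. *)
Lemma argmin_ratios_close (R : realType) (s k : nat) (Theta : set 'rV[R]_s)
    (f : R -> 'rV[R]_s -> R) (y : 'I_k -> R) (g : 'I_k -> R)
    (theta theta' : 'rV[R]_s) (eta : R) :
  Theta theta ->
  is_argmin Theta (fun t => dist_variations y (f ^~ t) g) theta' ->
  (forall i j,
     `|g i / g j - f (y i) theta / f (y j) theta| < eta) ->
  forall i j, `|f (y i) theta' / f (y j) theta' -
                f (y i) theta / f (y j) theta| < (k * k).+1%:R * eta.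
Proof.
move=> th [_ /(_ _ th) le_d] hg i j.
rewrite -(subrKA (g i / g j)) mulrSr mulrDl mul1r.
apply: le_lt_trans (ler_normD _ _) _; apply: ler_ltD; last exact: hg.
rewrite distrC.
apply: le_trans (dist_variations_term_le y (f ^~ theta') g i j) _.
apply: le_trans le_d _.
apply: (@le_trans _ _ (\sum_(i < k) \sum_(j < k) eta)).
  by apply: ler_sum => a _; apply: ler_sum => b _; exact: ltW.
by rewrite !sumr_const !card_ord -mulrnA mulr_natl.
Qed.

Lemma frequency_ge0 (R : realType) (k n : nat) (C : 'I_k -> set R)
    (x : 'I_n -> R) (i : 'I_k) : 0 <= frequency C x i.
Proof.
by apply: divr_ge0; do ?[apply: sumr_ge0 => ? _].
Qed.

Theorem proposition12 (R : realType) (c : setting) (s k : nat)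
    (Theta : set 'rV[R]_s) (XX : set R) (f : R -> 'rV[R]_s -> R)
    (K : R -> R) (T : 'I_s -> R -> R) (A : 'rV[R]_s -> R)
    (XX_Borel : measurable XX)
    (f_law : forall theta, Theta theta -> is_probability_law c (f ^~ theta))
    (f_supp : forall theta, Theta theta -> XX = [set x | 0 < f x theta])
    (f_exp : exponential_form Theta XX f K T A)
    (y : 'I_k -> R) (y_basis : basis_of_observations Theta XX f y)
    (d : measure_display) (Omega : measurableType d) (P : probability Omega R)
    (X : nat -> {RV P >-> R}) (theta : 'rV[R]_s) (theta_in : Theta theta)
    (X_indep : mutually_independent X)
    (X_law : forall m, has_law c (X m) (f ^~ theta))
    (fhat : nat -> Omega -> 'I_k -> R)
    (fhat_emp : empirical_distribution c y X fhat)
    (fhat_cvg : c = ContinuousCase -> forall i j,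
       cvg_in_probability P (fun n w => fhat n w i / fhat n w j)
         (f (y i) theta / f (y j) theta))
    (theta_n : nat -> Omega -> 'rV[R]_s)
    (theta_n_meas : forall n j,
       measurable_fun setT (fun w => theta_n n w ord0 j))
    (theta_n_Theta : forall n w, Theta (theta_n n w))
    (theta_n_min : forall n w, (forall i, 0 < fhat n w i) ->
       is_argmin Theta (fun theta' => dist_variations y (f ^~ theta') (fhat n w))
         (theta_n n w))
    (Theta_convex : convex_set Theta)
    (theta_interior : Theta° theta) :
  cvg_in_probability P theta_n theta.
Proof.
have [k2 _ _ _] := y_basis.
pose i0 : 'I_k := Ordinal (ltnW k2).
have f0 i : 0 < f (y i) theta := basis_gt0 f_supp y_basis i theta_in.
have fhat_ge0 n w i : 0 <= fhat n w i.
  case: c {f_law X_law fhat_cvg} fhat_emp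
    => /= [->|[_ [C [_ ->]]]]; exact: frequency_ge0.
have ratio_cvg i j : cvg_in_probability P (fun n w => fhat n w i / fhat n w j)
    (f (y i) theta / f (y j) theta).
  case: c {f_law} fhat_emp X_law fhat_cvg => /= [hE law _|_ _]; last exact.
  have -> : fhat = fun n w =>
      frequency (fun l => [set y l]) (fun m : 'I_n => X m w).
    by apply/funext => n; apply/funext => w; apply/funext => l.
  exact: (cvg_frequency_ratio X_indep law (y := y) i (f0 j)).
have fhat_meas n i : measurable_fun setT (fun w => fhat n w i).
  case: c {f_law X_law fhat_cvg} fhat_emp => /= [hE|[+ _]]; last exact.
  under eq_fun do rewrite hE.
  have mN j : measurable_fun setT
      (fun w => \sum_(m < n) \1_[set y j] (X m w) : R).
    apply: measurable_sum => m.
    by apply: measurableT_comp => //; exact: measurable_indic.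
  apply: measurable_funM => //; apply: measurable_fun_inv.
  exact: measurable_sum.
apply: (@cvg_in_probability_controlled _ _ _ _ _ ('I_k * 'I_k)%type
  (fun ij n w => fhat n w ij.1 / fhat n w ij.2)
  (fun ij => f (y ij.1) theta / f (y ij.2) theta)).
- move=> ij n; apply: measurable_funM => //; exact: measurable_fun_inv.
- move=> e n e0; exact: measurable_rV_dist_ge.
- by move=> ij; exact: ratio_cvg.
move=> e e0.
have [delta delta0 stable] :=
  ratios_stable f_supp f_exp y_basis i0 theta_interior e0.
(* The bound 1 makes the frequencies positive: a vanishing frequency has ratio
   0 to itself, at distance 1 from the true ratio. *)
exists (Num.min 1 (delta / (k * k).+1%:R)).
  by rewrite lt_min ltr01 divr_gt0.
move=> n w close.
have fhat_gt0 i : 0 < fhat n w i.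
  rewrite lt_neqAle fhat_ge0 andbT eq_sym; apply/eqP => fi0.
  have := close (i, i); rewrite /= fi0 mul0r sub0r divff ?gt_eqF//.
  by rewrite normrN1 lt_min ltxx.
apply: stable => [|i]; first exact: theta_n_Theta.
have /lt_le_trans := argmin_ratios_close theta_in (theta_n_min n w fhat_gt0)
  (fun a b => close (a, b)) i i0.
by apply; rewrite mulrC -ler_pdivlMr// ge_min lexx orbT.
Qed.
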